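(* Let $\mathcal H$ be a separable infinite-dimensional Hilbert space and let $T=(T_1,\ldots,T_n)\in B(\mathcal H)^n$ be a quasi-nilpotent $n$-tuple of operators. Let $K=(K_1,\ldots,K_n)$ be a quasi-nilpotent weighted left multi-shift of compact operators in $B(\mathcal H)$, and $\mathcal R\subset\mathcal H\otimes F^2(H_n)$ a joint invariant (closed) subspace under the operators $K_i^*\otimes I_{F^2(H_n)}$, $i\in\{1,\ldots,n\}$, such that $(T_1,\ldots,T_n)$ is jointly similar to $(P_{\mathcal R}(K_1\otimes I_{F^2(H_n)})|_{\mathcal R},\ldots,P_{\mathcal R}(K_n\otimes I_{F^2(H_n)})|_{\mathcal R})$. Then the $n$-tuple $(K_1\otimes I_{F^2(H_n)},\ldots,K_n\otimes I_{F^2(H_n)})$ is jointly quasi-similar to an $n$-tuple $(L_1,\ldots,L_n)$, where each $L_i\in B(\mathcal H\otimes F^2(H_n))$ is a compact operator; i.e. there exist quasi-affinities $X$ and $Y$ in $B(\mathcal H\otimes F^2(H_n))$ such that $$(K_i^*\otimes I_{F^2(H_n)})X=XL_i^*,\qquad Y(K_i^*\otimes I_{F^2(H_n)})=L_i^*Y$$ for any $i\in\{1,\ldots,n\}$.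
   Context: Let $n\ge 1$ and let $\mathbb F_n^+$ be the unital free semigroup on generators $g_1,\ldots,g_n$ with identity $g_0$; $|\alpha|$ is the length of $\alpha$. $F^2(H_n)$ is the full Fock space, a Hilbert space with orthonormal basis $\{e_\alpha\}_{\alpha\in\mathbb F_n^+}$. For operators $T_1,\ldots,T_n$, $T_\alpha:=T_{i_1}\cdots T_{i_k}$ if $\alpha=g_{i_1}\cdots g_{i_k}$, $T_{g_0}:=I$. A weighted left multi-shift in $B(\mathcal H)$ is an $n$-tuple $K$ with $K_iv_\alpha=\kappa_{g_i\alpha}v_{g_i\alpha}$ for some orthonormal basis $\{v_\alpha\}_{\alpha\in\mathbb F_n^+}$ of $\mathcal H$ and nonnegative weights $\{\kappa_\beta\}_{|\beta|\ge1}$ with $\sup_\alpha\kappa_{g_i\alpha}<\infty$. The joint spectral radius is $r(T):=\lim_{k\to\infty}\|\sum_{|\alpha|=k}T_\alpha T_\alpha^*\|^{1/2k}$; $T$ is quasi-nilpotent if $r(T)=0$. Joint similarity of $n$-tuples means simultaneous similarity by one invertible operator. A quasi-affinity is a bounded injective operator with dense range. (For every such $T$ the paper shows that such $K$ and $\mathcal R$ exist.) *)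

(* Defs.v *)
From HB Require Import structures.
From mathcomp Require Import all_boot all_order all_algebra.
From mathcomp Require Import sesquilinear complex.
From mathcomp Require Import all_classical all_reals all_analysis.

Set Implicit Arguments.
Unset Strict Implicit.
Unset Printing Implicit Defensive.

Import Order.TTheory GRing.Theory Num.Theory.
Import numFieldNormedType.Exports.

Local Open Scope classical_set_scope.
Local Open Scope ring_scope.
Local Open Scope complex_scope.

(* Complex Hilbert spaces.  The inner product is linear in its first argument
   and conjugate-linear in the second; the library norm of a normed module
   over R[i] is a nonnegative real element of R[i]. *)
HB.mixin Record CompleteNormedModule_isHilbert (R : realType) H
    & CompleteNormedModule R[i] H := {
  inner : {dot H for (@Num.conj R[i])} ;
  inner_norm : forall x : H, inner x x = `|x| ^+ 2
}.

#[short(type="hilbertType")]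
HB.structure Definition Hilbert (R : realType) :=
  {H of CompleteNormedModule_isHilbert R H & CompleteNormedModule R[i] H}.

Section Hilbert_spaces.
Context {R : realType}.

Definition separable (H : hilbertType R) : Prop :=
  exists2 D : set H, countable D & dense D.

Definition infinite_dimensional (H : hilbertType R) : Prop :=
  ~ exists (m : nat) (b : 'I_m -> H),
      forall x, exists c : 'I_m -> R[i], x = \sum_(j < m) c j *: b j.

Definition linear_subspace (H : hilbertType R) (M : set H) : Prop :=
  M 0 /\ forall (a : R[i]) x y, M x -> M y -> M (a *: x + y).

Definition linear_span (H : hilbertType R) (A : set H) : set H :=
  smallest (@linear_subspace H) A.

Definition orthonormal_basis (I : eqType) (H : hilbertType R) (v : I -> H) :
    Prop :=
  (forall a b, inner (v a) (v b) = (a == b)%:R) /\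
  dense (linear_span (range v)).

(* [E] with the simple tensors [tens x y] is the Hilbert space tensor product
   of [H] and [F]; these two conditions determine the pair (E, tens) up to a
   unique unitary that fixes the simple tensors. *)
Definition hilbert_tensor_product (H F E : hilbertType R)
    (tens : {bilinear H -> F -> E}) : Prop :=
  (forall x x' y y',
     inner (tens x y) (tens x' y') = inner x x' * inner y y') /\
  dense (linear_span [set tens xy.1 xy.2 | xy in [set: H * F]]).

Definition bounded_operator (H E : hilbertType R) (A : H -> E) : Prop :=
  linear A /\ continuous A.

Definition compact_operator (H E : hilbertType R) (A : H -> E) : Prop :=
  linear A /\ precompact (A @` [set x | `|x| <= 1]).

Definition quasi_affinity (H E : hilbertType R) (X : H -> E) : Prop :=
  [/\ bounded_operator X, injective X & dense (range X)].

Definition opnorm (H E : hilbertType R) (A : H -> E) : R :=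
  sup [set complex.Re `|A x| | x in [set x : H | `|x| <= 1]].

(* In each of the following three definitions the function selected by [xget]
   exists and is unique when [A] is bounded, resp. when [M] is a closed
   subspace, so the default value 0 is then irrelevant. *)
Definition adj (H E : hilbertType R) (A : H -> E) : E -> H :=
  xget (fun=> 0)
    [set B | bounded_operator B /\
             forall x y, inner (A x) y = inner x (B y)].

Definition orth_proj (E : hilbertType R) (M : set E) : E -> E :=
  xget (fun=> 0)
    [set P | forall x, M (P x) /\ forall y, M y -> inner (x - P x) y = 0].

Definition ampliation (H F E : hilbertType R) (tens : {bilinear H -> F -> E})
    (A : H -> H) : E -> E :=
  xget (fun=> 0)
    [set B | bounded_operator B /\
             forall x y, B (tens x y) = tens (A x) y].

End Hilbert_spaces.

Section Tuples_of_operators.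
Context {R : realType} {n : nat}.

(* The free semigroup on g_1, ..., g_n is [seq 'I_n]: the identity g_0 is
   [::], the product is concatenation and g_i alpha is [i :: alpha]. *)

Definition word_op (H : hilbertType R) (T : 'I_n -> H -> H) (a : seq 'I_n) :
    H -> H :=
  foldr (fun i A => T i \o A) id a.

Definition word_square_sum (H : hilbertType R) (T : 'I_n -> H -> H) (k : nat) :
    H -> H :=
  fun x => \sum_(a : k.-tuple 'I_n) word_op T a (adj (word_op T a) x).

(* A relation rather than a use of [lim], whose value is arbitrary on
   divergent sequences. *)
Definition joint_spectral_radius (H : hilbertType R) (T : 'I_n -> H -> H)
    (r : R) : Prop :=
  (fun k => opnorm (word_square_sum T k) `^ (2 * k)%:R^-1) @ \oo --> r.

Definition quasi_nilpotent (H : hilbertType R) (T : 'I_n -> H -> H) : Prop :=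
  joint_spectral_radius T 0.

(* [kappa [::]] plays no role. *)
Definition weighted_left_multishift (H : hilbertType R) (K : 'I_n -> H -> H) :
    Prop :=
  (forall i, bounded_operator (K i)) /\
  exists (v : seq 'I_n -> H) (kappa : seq 'I_n -> R),
    [/\ orthonormal_basis v,
        forall i a, 0 <= kappa (i :: a),
        forall i, has_ubound (range (fun a => kappa (i :: a)))
      & forall i a, K i (v a) = (kappa (i :: a))%:C *: v (i :: a)].

(* Joint similarity of a tuple on [H] with a tuple [A] acting on the closed
   subspace [M] of [E]: [S] is the similarity, regarded as a map H -> M, and
   [S'] is its inverse M -> H. *)
Definition jointly_similar_on (H E : hilbertType R) (T : 'I_n -> H -> H)
    (M : set E) (A : 'I_n -> E -> E) : Prop :=
  exists (S : H -> E) (S' : E -> H),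
    [/\ bounded_operator S,
        {within M, continuous S'},
        (forall x, M (S x) /\ S' (S x) = x),
        (forall y, M y -> S (S' y) = y)
      & forall i x, S (T i x) = A i (S x)].

End Tuples_of_operators.

(* Main.v *)
(* The operators K_i (x) I form a direct sum of copies of K indexed by the words
   b. Since K is quasi-nilpotent, the products of its weights along words of
   length k are eventually below e^k for every e > 0, so K is similar, by a
   bounded invertible diagonal operator, to a multi-shift of norm at most e
   (Rota's renorming). Renorming the b-th copy with e_b -> 0 turns the direct sum
   into a compact tuple L: each summand is compact and their norms tend to 0. The
   diagonal similarities are not uniformly bounded in b, nor are their inverses,
   but rescaling them on each copy makes both direct sums contractions, which are
   injective with dense range and serve as X and Y. *)
Require Import Defs.
From HB Require Import structures.
From mathcomp Require Import all_boot all_order all_algebra.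
From mathcomp Require Import sesquilinear complex.
From mathcomp Require Import all_classical all_reals all_analysis.
Import Order.TTheory GRing.Theory Num.Theory.
Import numFieldNormedType.Exports.
Set Implicit Arguments.
Unset Strict Implicit.
Unset Printing Implicit Defensive.
Local Open Scope classical_set_scope.
Local Open Scope ring_scope.

(** * Hilbert space preliminaries *)

Section InnerProduct.
Context {R : realType} {E : hilbertType R}.
Implicit Types (x y z : E) (a : R[i]).

Lemma inner_conj x y : inner x y = (inner y x)^*.
Proof. by rewrite (hermC inner) expr0 mul1r. Qed.

Lemma innerDl x y z : inner (x + y) z = inner x z + inner y z.
Proof. exact: linearDl. Qed.

Lemma innerZl a x z : inner (a *: x) z = a * inner x z.
Proof. exact: linearZl_LR. Qed.

Lemma innerDr x y z : inner z (x + y) = inner z x + inner z y.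
Proof. exact: linearDr. Qed.

Lemma innerZr a x z : inner z (a *: x) = a^* * inner z x.
Proof. exact: linearZr_LR. Qed.

Lemma innerBl x y z : inner (x - y) z = inner x z - inner y z.
Proof. exact: linearBl. Qed.

Lemma innerBr x y z : inner z (x - y) = inner z x - inner z y.
Proof. exact: linearBr. Qed.

Lemma inner0l z : inner 0 z = 0.
Proof. exact: linear0l. Qed.

Lemma inner0r z : inner z 0 = 0.
Proof. exact: linear0r. Qed.

Lemma inner_sumr I (s : seq I) (F : I -> E) z :
  inner z (\sum_(i <- s) F i) = \sum_(i <- s) inner z (F i).
Proof. exact: linear_sumr. Qed.

Lemma norm_orthD x y : inner x y = 0 ->
  `|x + y| ^+ 2 = `|x| ^+ 2 + `|y| ^+ 2.
Proof.
move=> xy; have yx : inner y x = 0 by rewrite inner_conj xy conjC0.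
by rewrite -!inner_norm innerDl !innerDr xy yx addr0 add0r.
Qed.

(** Subtracting from [x] its projection [p] on the line of [y] leaves a remainder orthogonal to [p],
    so [p] is no longer than [x]. *)
Lemma cauchy_schwarz x y : `|inner x y| <= `|x| * `|y|.
Proof.
have [->|y0] := eqVneq y 0.
  by rewrite inner0r normr0 normr0 mulr0.
have yy0 : inner y y != 0 by rewrite inner_norm sqrf_eq0 normr_eq0.
pose p := (inner x y / inner y y) *: y.
have oxp : inner (x - p) p = 0.
  by rewrite /p innerBl !innerZr innerZl -mulrBr divfK // subrr mulr0.
have := norm_orthD oxp; rewrite subrK => xE.
have : `|p| ^+ 2 <= `|x| ^+ 2 by rewrite xE lerDr exprn_ge0.
rewrite ler_sqr ?nnegrE // normrZ normf_div.
rewrite inner_norm normrX normr_id expr2 invfM mulrA.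
by rewrite divfK ?normr_eq0 // ler_pdivrMr // normr_gt0.
Qed.

Lemma pythagoras (I : eqType) (s : seq I) (F : I -> E) : uniq s ->
  (forall i j, i != j -> inner (F i) (F j) = 0) ->
  `|\sum_(i <- s) F i| ^+ 2 = \sum_(i <- s) `|F i| ^+ 2.
Proof.
move=> + oF; elim: s => [|i s ih] /=; first by rewrite !big_nil normr0 expr0n.
move=> /andP[si us]; rewrite !big_cons -ih // norm_orthD //.
rewrite inner_sumr big_seq big1 // => j js; apply: oF.
by apply: contraNneq si => ->.
Qed.

(** [p] is the orthogonal projection of [x] on the span of the chosen vectors, and its squared norm
    is the sum on the left. *)
Lemma bessel (I : eqType) (u : I -> E) (s : seq I) x : uniq s ->
  (forall i j, inner (u i) (u j) = (i == j)%:R) ->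
  \sum_(i <- s) `|inner x (u i)| ^+ 2 <= `|x| ^+ 2.
Proof.
move=> us ou; pose p := \sum_(i <- s) inner x (u i) *: u i.
have pE : `|p| ^+ 2 = \sum_(i <- s) `|inner x (u i)| ^+ 2.
  rewrite pythagoras //; last first.
    by move=> i j /negPf ij; rewrite innerZl innerZr ou ij !mulr0.
  apply: eq_bigr => i _.
  by rewrite normrZ exprMn -[`|u i| ^+ 2]inner_norm ou eqxx mulr1.
have xp : inner x p = `|p| ^+ 2.
  rewrite pE inner_sumr; apply: eq_bigr => i _.
  by rewrite innerZr normCK mulrC.
have oxp : inner (x - p) p = 0 by rewrite innerBl xp inner_norm subrr.
have := norm_orthD oxp; rewrite subrK => ->.
by rewrite -pE lerDr exprn_ge0.
Qed.

End InnerProduct.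

Section BoundedOperators.
Context {R : realType}.
Implicit Types (H E F : hilbertType R).

Lemma bounded_operatorP H E (A : H -> E) :
  bounded_operator A <->
  linear A /\ exists2 C : R[i], 0 <= C & forall x, `|A x| <= C * `|x|.
Proof.
split=> -[linA bA]; split=> //.
- pose A' : {linear H -> E} := HB.pack A (GRing.isLinear.Build _ _ _ _ A linA).
  have /linear_boundedP : bounded_near A' (nbhs 0).
    exact/linear_bounded_continuous.
  by move=> /pinfty_ex_gt0[C C0 AC]; exists C => //; exact: ltW.
- pose A' : {linear H -> E} := HB.pack A (GRing.isLinear.Build _ _ _ _ A linA).
  case: bA => C C0 AC.
  apply/(@linear_bounded_continuous _ _ _ A')/linear_boundedP.
  exists C; split; first exact: ger0_real.
  by move=> r /ltW Cr x; rewrite (le_trans (AC x)) // ler_wpM2r.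
Qed.

Lemma bounded_operatorB H E (A : H -> E) x y : bounded_operator A ->
  A (x - y) = A x - A y.
Proof.
move=> [linA _].
by have := linA (-1) y x; rewrite !scaleN1r ![- _ + _]addrC.
Qed.

Lemma bounded_operator0 H E (A : H -> E) : bounded_operator A -> A 0 = 0.
Proof. by move=> bA; rewrite -(subrr 0) bounded_operatorB // subrr. Qed.

Lemma bounded_operatorZ H E (A : H -> E) a x : bounded_operator A ->
  A (a *: x) = a *: A x.
Proof.
move=> bA; have [linA _] := bA.
by have := linA a x 0; rewrite (bounded_operator0 bA) !addr0.
Qed.

Lemma bounded_operator_id H : bounded_operator (@id H).
Proof. by split=> //= x; exact: cvg_id. Qed.

Lemma bounded_operator_comp H E F (A : E -> F) (B : H -> E) :
  bounded_operator A -> bounded_operator B -> bounded_operator (A \o B).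
Proof.
move=> [linA cA] [linB cB]; split; last first.
  by move=> x; apply: continuous_comp; [exact: cB|exact: cA].
by move=> a x y /=; rewrite linB linA.
Qed.

Lemma bounded_operator_sum H E I (s : seq I) (A : I -> H -> E) :
  (forall i, bounded_operator (A i)) ->
  bounded_operator (fun x => \sum_(i <- s) A i x).
Proof.
move=> bA; apply/bounded_operatorP; split.
  move=> a x y; rewrite scaler_sumr -big_split; apply: eq_bigr => i _.
  by have [-> _] := bA i.
elim: s => [|i s [C C0 ih]].
  by exists 0 => // x; rewrite big_nil normr0 mul0r.
have /bounded_operatorP[_ [D D0 AD]] := bA i.
exists (D + C); first exact: addr_ge0.
by move=> x; rewrite big_cons mulrDl (le_trans (ler_normD _ _)) // lerD.
Qed.

(** The function chosen in [adj] is an adjoint as soon as some adjoint exists; the proofs below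
    therefore begin by exhibiting one. *)
Lemma adj_spec H E (A : H -> E) :
  (exists B, bounded_operator B /\ forall x y, inner (A x) y = inner x (B y)) ->
  bounded_operator (adj A) /\ forall x y, inner (A x) y = inner x (adj A y).
Proof. by move=> [B AB]; rewrite /adj; case: xgetP => [_ -> //|/(_ B)]. Qed.

End BoundedOperators.

(** * Extension of identities by density *)

Section DenseSpan.
Context {R : realType} {E : hilbertType R}.


Lemma dense_approx (D : set E) (x : E) (e : R[i]) : dense D -> 0 < e ->
  exists2 y, D y & `|x - y| < e.
Proof.
move=> dD e0; have [] := dD (ball x e).
- by exists x; exact: ballxx.
- exact: ball_open.
- by move=> y [/= + Dy]; rewrite -ball_normE /=; exists y.
Qed.

(** An induction principle: [linear_span S] is the smallest subspace containing [S], so it lies in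
    [P], and density together with closedness of [P] gives the rest. *)
Lemma closed_subspace_total (S P : set E) : dense (linear_span S) ->
  linear_subspace P -> S `<=` P ->
  (forall x, (forall e : R[i], 0 < e -> exists2 y, P y & `|x - y| < e) -> P x) ->
  forall x, P x.
Proof.
move=> dS lP SP clP x; apply: clP => e e0.
have [y Sy xy] := dense_approx x dS e0.
by exists y => //; exact: Sy.
Qed.

(** The zero set of [f] is a subspace, closed by the Lipschitz bound. The target [V] covers both
    vector-valued maps and scalar expressions in inner products. *)
Lemma lipschitz_eq0 (V : normedZmodType R[i]) (S : set E) (f : E -> V) (C : R[i]) :
  0 <= C -> dense (linear_span S) -> f 0 = 0 ->
  (forall a x y, f x = 0 -> f y = 0 -> f (a *: x + y) = 0) ->
  (forall x y, `|f x - f y| <= C * `|x - y|) ->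
  (forall x, S x -> f x = 0) -> forall x, f x = 0.
Proof.
move=> C0 dS f0 flin fC fS; apply: (closed_subspace_total dS) => //.
move=> x xP; apply/eqP; rewrite -normr_le0; apply/ler_addgt0Pr => e e0.
rewrite add0r.
(* [C + 1] is a legitimate divisor even when [C] is 0. *)
have d0 : 0 < e / (C + 1) by rewrite divr_gt0 // ltr_wpDl.
have [y /= fy /ltW xy] := xP _ d0.
have := fC x y; rewrite fy subr0 => /le_trans; apply.
rewrite (le_trans (ler_wpM2l C0 xy)) // mulrCA ger_pMr //.
by rewrite ler_pdivrMr ?mul1r ?lerDl // ltr_wpDl.
Qed.

End DenseSpan.

(** * Operators given by weights on an orthonormal basis *)

Lemma subr_subACA (V : zmodType) (a b c d : V) :
  a - b - (c - d) = (a - c) - (b - d).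
Proof. by rewrite !opprB [d - c]addrC addrACA [- b + d]addrC. Qed.

Section OrthonormalBasis.
Context {R : realType} {I : eqType} {E : hilbertType R} (u : I -> E).
Hypothesis u_onb : orthonormal_basis u.
Implicit Types F : hilbertType R.

Lemma onb_norm i : `|u i| = 1.
Proof.
have [ou _] := u_onb; apply/eqP.
by rewrite -(@eqrXn2 _ 2) // expr1n -inner_norm ou eqxx.
Qed.

Lemma onb_eq F (A B : E -> F) : bounded_operator A -> bounded_operator B ->
  (forall i, A (u i) = B (u i)) -> A =1 B.
Proof.
move=> bA bB AB x; apply/eqP; rewrite -subr_eq0; apply/eqP; move: x.
have /bounded_operatorP[linA [C C0 AC]] := bA.
have /bounded_operatorP[linB [D D0 BD]] := bB.
apply: (@lipschitz_eq0 _ _ _ _ (fun x => A x - B x) (C + D) _ u_onb.2).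
- exact: addr_ge0.
- by rewrite (bounded_operator0 bA) (bounded_operator0 bB) subrr.
- move=> a x y /subr0_eq ABx /subr0_eq ABy.
  by rewrite linA linB ABx ABy subrr.
- move=> x y; rewrite subr_subACA -(bounded_operatorB _ _ bA).
  rewrite -(bounded_operatorB _ _ bB) mulrDl.
  by rewrite (le_trans (ler_normB _ _)) // lerD.
- by move=> _ [i _ <-]; rewrite AB subrr.
Qed.

Lemma onb_inner_inj (x y : E) :
  (forall i, inner (u i) x = inner (u i) y) -> x = y.
Proof.
move=> xy; apply/eqP; rewrite -subr_eq0 -normr_eq0 -sqrf_eq0 -inner_norm.
(* Only the first argument is generalized: the functional orthogonal to the basis is shown to vanish
   everywhere, in particular at [x - y]. *)
apply/eqP; move: {1}(x - y).
apply: (@lipschitz_eq0 _ _ _ _ (fun z => inner z (x - y)) `|x - y| _ u_onb.2).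
- by [].
- exact: inner0l.
- by move=> a z t z0 t0; rewrite innerDl innerZl z0 t0 mulr0 addr0.
- by move=> z t; rewrite -innerBl mulrC cauchy_schwarz.
- by move=> _ [i _ <-]; rewrite innerBr xy subrr.
Qed.

(** Density is used twice: in [x] with [y] fixed, then in [y] with [x] a basis vector. *)
Lemma onb_adjoint {J : eqType} F (v : J -> F) (A : E -> F) (B : F -> E) :
  orthonormal_basis v -> bounded_operator A -> bounded_operator B ->
  (forall i j, inner (A (u i)) (v j) = inner (u i) (B (v j))) ->
  forall x y, inner (A x) y = inner x (B y).
Proof.
move=> v_onb bA bB AB x y; apply/eqP; rewrite -subr_eq0; apply/eqP; move: x.
have /bounded_operatorP[linA [C C0 AC]] := bA.
have /bounded_operatorP[linB [D D0 BD]] := bB.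
apply: (@lipschitz_eq0 _ _ _ _ (fun x => inner (A x) y - inner x (B y))
  (C * `|y| + `|B y|) _ u_onb.2).
- by rewrite addr_ge0 // mulr_ge0.
- by rewrite (bounded_operator0 bA) !inner0l subrr.
- move=> a x z /subr0_eq xE /subr0_eq zE.
  by rewrite linA !innerDl !innerZl xE zE subrr.
- move=> x z; rewrite subr_subACA -!innerBl -(bounded_operatorB _ _ bA) mulrDl.
  rewrite (le_trans (ler_normB _ _)) // lerD //.
    by rewrite (le_trans (cauchy_schwarz _ _)) // mulrAC ler_wpM2r.
  by rewrite (le_trans (cauchy_schwarz _ _)) // mulrC.
move=> _ [i _ <-].
apply/eqP; rewrite subr_eq0; apply/eqP.
(* Conjugation moves [y] into the linear argument of the inner product. *)
rewrite inner_conj [RHS]inner_conj; congr (_^*); apply/eqP; rewrite -subr_eq0.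
apply/eqP; move: y.
apply: (@lipschitz_eq0 _ _ _ _ (fun y => inner y (A (u i)) - inner (B y) (u i))
  (`|A (u i)| + D * `|u i|) _ v_onb.2).
- by rewrite addr_ge0 // mulr_ge0.
- by rewrite (bounded_operator0 bB) !inner0l subrr.
- move=> a x z /subr0_eq xE /subr0_eq zE.
  by rewrite linB !innerDl !innerZl xE zE subrr.
- move=> x z; rewrite subr_subACA -!innerBl -(bounded_operatorB _ _ bB) mulrDl.
  rewrite (le_trans (ler_normB _ _)) // lerD //.
    by rewrite (le_trans (cauchy_schwarz _ _)) // mulrC.
  by rewrite (le_trans (cauchy_schwarz _ _)) // mulrAC ler_wpM2r.
move=> _ [j _ <-].
by rewrite [inner (v j) _]inner_conj AB -inner_conj subrr.
Qed.

End OrthonormalBasis.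

(** * Weighted partial shifts as pointwise limits of finite sums *)

Section WeightedPartialShift.
Context {R : realType} {I : countType} {E : hilbertType R} (u : I -> E).
Hypothesis u_onb : orthonormal_basis u.

(** The indices with code below [N]. Some numbers may code no index, so there can be fewer than [N]
    of them. *)
Definition initial (N : nat) : seq I := pmap (@pickle_inv I) (iota 0 N).

Lemma initial_uniq N : uniq (initial N).
Proof. by rewrite (pmap_uniq (@pickle_invK I)) // iota_uniq. Qed.

Lemma mem_initial N i : (i \in initial N) = (pickle i < N)%N.
Proof.
by rewrite (can2_mem_pmap (@pickle_invK I) (@pickleK_inv I)) mem_iota.
Qed.

Variables (sh : I -> I) (w : I -> R[i]).
Hypothesis sh_inj : forall i j, w i != 0 -> w j != 0 -> sh i = sh j -> i = j.

(** Truncation to [s] of the operator sending [u i] to [w i *: u (sh i)]. Injectivity of [sh] is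
    asked only where the weights are nonzero, so that [behead] qualifies and backward shifts are
    covered too. *)
Definition partial_shift (s : seq I) (x : E) : E :=
  \sum_(i <- s) (w i * inner x (u i)) *: u (sh i).

Lemma partial_shift_linear s : linear (partial_shift s).
Proof.
move=> a x y; rewrite /partial_shift scaler_sumr -big_split.
apply: eq_bigr => i _ /=.
by rewrite innerDl innerZl mulrDr scalerDl scalerA mulrCA.
Qed.

(** The nonzero terms are pairwise orthogonal, so Pythagoras and Bessel apply. The bound does not
    depend on [s], which is what makes the truncations converge. *)
Lemma partial_shift_le s (C : R[i]) x : uniq s -> 0 <= C ->
  (forall i, i \in s -> `|w i| <= C) -> `|partial_shift s x| <= C * `|x|.
Proof.
move=> us C0 wC; have [ou _] := u_onb.
rewrite -ler_sqr ?nnegrE ?mulr_ge0 // exprMn.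
rewrite pythagoras //; last first.
  move=> i j ij; rewrite innerZl innerZr ou.
  have [shij|] := eqVneq (sh i) (sh j); last by rewrite !mulr0.
  have [->|wi] := eqVneq (w i) 0; first by rewrite !mul0r.
  have [->|wj] := eqVneq (w j) 0; first by rewrite mul0r conjC0 mul0r mulr0.
  by rewrite (sh_inj wi wj shij) eqxx in ij.
rewrite (le_trans _ (ler_wpM2l (exprn_ge0 2 C0) (bessel x us ou))) //.
rewrite mulr_sumr big_seq [leRHS]big_seq ler_sum // => i si.
rewrite normrZ (onb_norm u_onb) mulr1 normrM exprMn ler_wpM2r ?exprn_ge0 //.
by rewrite lerXn2r ?nnegrE // wC.
Qed.

Lemma partial_shift_onb s i : uniq s ->
  partial_shift s (u i) = if i \in s then w i *: u (sh i) else 0.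
Proof.
move=> us; have [ou _] := u_onb; rewrite /partial_shift.
case: ifPn => si.
  rewrite (bigD1_seq i) //= ou eqxx mulr1 big1 ?addr0 // => j /negPf ji.
  by rewrite ou eq_sym ji mulr0 scale0r.
rewrite big_seq big1 // => j sj; rewrite ou.
by rewrite (negPf (contraNneq _ si)) ?mulr0 ?scale0r // => ->.
Qed.

Variable C : R[i].
Hypotheses (C_ge0 : 0 <= C) (w_le : forall i, `|w i| <= C).

(** The vectors at which the truncations converge form a subspace. It contains each [u i], where the
    truncations are eventually constant, and it is closed because they are uniformly bounded. *)
Lemma partial_shift_cvg x : cvg (partial_shift (initial n) x @[n --> \oo]).
Proof.
move: x; apply: (closed_subspace_total u_onb.2).
- split=> [|a x y cx cy].
    apply: (@cvgP _ _ 0); apply: cvg_near_cst; near=> n.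
    rewrite /partial_shift big1 // => i _.
    by rewrite inner0l mulr0 scale0r.
  under eq_fun do rewrite partial_shift_linear.
  by apply: is_cvgD => //; exact: is_cvgZl_tmp.
- move=> _ [i _ <-]; apply: (@cvgP _ _ (w i *: u (sh i))).
  apply: cvg_near_cst; near=> n.
  rewrite partial_shift_onb ?initial_uniq // mem_initial ifT //.
  by near: n; exact: nbhs_infty_gt.
move=> x xP; apply: cauchy_cvg; apply: cauchy_exP => e e0.
(* At this distance the truncations of [x] and of [y] differ by at most [e / 2], whatever [n] is. *)
have d0 : 0 < e / 2 / (C + 1) by rewrite divr_gt0 ?divr_gt0 // ltr_wpDl.
have [y cy xy] := xP _ d0.
exists (lim (partial_shift (initial n) y @[n --> \oo])).
have e20 : 0 < e / 2 by rewrite divr_gt0.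
set l := lim _; rewrite -ball_normE.
suff : \forall n \near \oo, `|l - partial_shift (initial n) x| < e by [].
near=> n; have -> : l - partial_shift (initial n) x =
    (l - partial_shift (initial n) y) - partial_shift (initial n) (x - y).
  have := partial_shift_linear (initial n) (-1) y x.
  rewrite !scaleN1r ![- _ + _]addrC => ->.
  by rewrite opprB addrA subrK.
rewrite [e]splitr (le_lt_trans (ler_normB _ _)) // ltr_leD //.
  by near: n; exact: cvgr_dist_lt.
rewrite (le_trans (partial_shift_le _ _ C_ge0 _)) ?initial_uniq //.
rewrite (le_trans (ler_wpM2l C_ge0 (ltW xy))) // mulrCA ger_pMr //.
by rewrite ler_pdivrMr ?mul1r ?lerDl // ltr_wpDl.
Unshelve. all: by end_near. Qed.

Lemma weighted_partial_shift : exists A : E -> E, [/\ bounded_operator A,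
  (forall i, A (u i) = w i *: u (sh i)) & forall x, `|A x| <= C * `|x| ].
Proof.
pose A x := lim (partial_shift (initial n) x @[n --> \oo]).
have linA : linear A.
  move=> a x y; apply: cvg_lim => //.
  under eq_fun do rewrite partial_shift_linear.
  by apply: cvgD; [apply: cvgZl_tmp|]; exact: partial_shift_cvg.
have AC x : `|A x| <= C * `|x|.
  apply/ler_addgt0Pr => e e0.
  near \oo => n.
  rewrite -[A x](subrK (partial_shift (initial n) x)).
  rewrite (le_trans (ler_normD _ _)) // addrC lerD //.
    by apply: partial_shift_le; rewrite ?initial_uniq.
  apply: ltW; near: n.
  by have := @partial_shift_cvg x; move/cvgr_dist_lt; apply.
exists A; split=> //.
  by apply/bounded_operatorP; split=> //; exists C.
move=> i; apply: cvg_lim => //; apply: cvg_near_cst; near=> n.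
rewrite partial_shift_onb ?initial_uniq // mem_initial ifT //.
by near: n; exact: nbhs_infty_gt.
Unshelve. all: by end_near. Qed.

End WeightedPartialShift.

(** * Compactness *)

Section ComplexNorm.
Context {R : realType}.

Lemma norm_real_complex (r : R) : `|r%:C%C| = `|r|%:C%C.
Proof. by rewrite normc_def /= expr0n addr0 sqrtr_sqr. Qed.

Lemma gt0_real_complex (e : R[i]) : 0 < e ->
  exists2 r : R, 0 < r & e = r%:C%C.
Proof.
move=> e0; exists (complex.Re e); first by move: e0; rewrite ltcE => /andP[].
by rewrite RRe_real // gtr0_real.
Qed.

Lemma norm_Re_le (c : R[i]) : `|complex.Re c| <= complex.Re `|c|.
Proof. by have := normc_ge_Re c; rewrite lecE => /andP[]. Qed.

Lemma norm_Im_le (c : R[i]) : `|complex.Im c| <= complex.Re `|c|.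
Proof.
rewrite -normrN -ReiNIm (le_trans (norm_Re_le _)) // normrM.
have -> : `|'i%C : R[i]| = 1 by rewrite normc_def /= expr0n add0r expr1n sqrtr1.
by rewrite mulr1.
Qed.

End ComplexNorm.

Section Compactness.
Context {R : realType} {E : hilbertType R}.

(** An ultrafilter containing the closure of [S] is shown to be Cauchy; completeness then gives its
    limit. *)
Lemma totally_bounded_precompact (S : set E) :
  (forall e : R[i], 0 < e -> exists2 D : set E, compact D &
    forall y, S y -> exists2 d, D d & `|y - d| < e) ->
  precompact S.
Proof.
move=> totS; rewrite precompactE compact_ultra => F FU FS.
have cF : cauchy_ex F.
  move=> e e0; have e30 : 0 < e / 3 by rewrite divr_gt0.
  have e3 : e = e / 3 + (e / 3 + e / 3).
    by rewrite -[RHS]/((e / 3) *+ 3) -mulr_natr divfK // pnatr_eq0.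
  apply: contrapT => /forallNP nF.
  have [D cD SD] := totS _ e30.
  (* If no ball of radius [e] belongs to the ultrafilter, compactness of [D] makes almost every
     point stay at least two thirds of [e] away from all of [D] at once. A point of the closure of
     [S] contradicts this. *)
  have /compact_near_coveringP /(_ E F (fun i x => ~ `|x - i| < e / 3 + e / 3)) := cD.
  have DF x : D x -> \forall x' \near x & i \near F, ~ `|x' - i| < e / 3 + e / 3.
    move=> _; have [/nF//|Fx] := in_ultra_setVsetC (ball x e) FU.
    exists (ball x (e / 3), ~` ball x e).
      by split=> //=; exact: nbhsx_ballx.
    move=> [x' i] /= []; rewrite -!ball_normE /= => xx' xi x'i; apply: xi.
    rewrite -(subrK x' x) -addrA (le_lt_trans (ler_normD _ _)) //.
    by rewrite [ltRHS]e3 ltrD.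
  move=> /(_ _ DF) FD; have [z [/= Sz zD]] := filter_ex (filterI FS FD).
  have [y [Sy /=]] := Sz _ (nbhsx_ballx z _ e30).
  rewrite -ball_normE /= => zy; have [d Dd yd] := SD _ Sy.
  apply: (zD _ Dd); rewrite -(subrK y d) -addrA (le_lt_trans (ler_normD _ _)) //.
  by rewrite ltrD // distrC.
have /cauchy_cvg/cvg_ex[p Fp] : cauchy F by exact: cauchy_exP.
exists p; split=> //; apply: closed_closure => B /Fp FB.
exact: filter_ex (filterI FS FB).
Qed.

Lemma real_scale_continuous (z : E) :
  continuous (fun a : R => a%:C%C *: z : E).
Proof.
move=> a; apply/cvgrPdist_lt => e /gt0_real_complex[r r0 ->].
have [d d0 zE] : exists2 d : R, 0 < d & `|z| + 1 = d%:C%C.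
  by apply: gt0_real_complex; rewrite ltr_wpDl.
have z1 : `|z| <= d%:C%C by rewrite -zE lerDl.
near=> b; rewrite -scalerBl -rmorphB normrZ norm_real_complex.
rewrite (le_lt_trans (ler_wpM2l _ z1)) ?ler0c // -rmorphM ltcR.
rewrite -ltr_pdivlMr //; near: b.
by apply: cvgr_dist_lt; [exact: cvg_id|exact: divr_gt0].
Unshelve. all: by end_near. Qed.

(** By induction on [s]: each step takes the image of a square times a compact set under a
    continuous map, the square holding the real and imaginary parts of the new coefficient. *)
Lemma compact_combinations (I : eqType) (s : seq I) (z : I -> E) (C : R[i]) :
  exists2 D : set E, compact D & forall c : I -> R[i],
    (forall i, `|c i| <= C) -> D (\sum_(i <- s) c i *: z i).
Proof.
elim: s => [|i s [D cD DP]].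
  by exists [set 0]; [exact: compact_set1|move=> c _; rewrite big_nil].
pose r := complex.Re C.
pose f (t : R * R * E) : E :=
  t.1.1%:C%C *: z i + t.1.2%:C%C *: ('i%C *: z i) + t.2.
exists (f @` ((`[- r, r]%classic `*` `[- r, r]%classic) `*` D)).
  apply: continuous_compact.
    apply: continuous_subspaceT => t; apply: cvgD; last exact: cvg_snd.
    apply: cvgD.
      apply: (continuous_comp (f := fun t : R * R * E => t.1.1)
        (g := fun a : R => a%:C%C *: z i)); last exact: real_scale_continuous.
      by apply: continuous_comp; exact: cvg_fst.
    apply: (continuous_comp (f := fun t : R * R * E => t.1.2)
      (g := fun a : R => a%:C%C *: ('i%C *: z i))).
      by apply: continuous_comp; [exact: cvg_fst|exact: cvg_snd].
    exact: real_scale_continuous.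
  by apply: compact_setX => //; apply: compact_setX; exact: segment_compact.
move=> c cC; exists (complex.Re (c i), complex.Im (c i), \sum_(j <- s) c j *: z j).
  have ReC : complex.Re `|c i| <= r.
    by move: (cC i); rewrite lecE => /andP[].
  by split=> //=; [split|exact: DP]; rewrite /= in_itv /= -ler_norml
    (le_trans _ ReC) ?norm_Re_le ?norm_Im_le.
rewrite /f /= big_cons scalerA -scalerDl; congr (_ *: _ + _).
by rewrite mulrC -complexE.
Qed.

End Compactness.

Section CompactShift.
Context {R : realType} {I : countType} {E : hilbertType R} (u : I -> E).
Hypothesis u_onb : orthonormal_basis u.
Variables (sh : I -> I) (w : I -> R[i]) (C : R[i]).
Hypothesis sh_inj : forall i j, w i != 0 -> w j != 0 -> sh i = sh j -> i = j.
Hypotheses (C_ge0 : 0 <= C) (w_le : forall i, `|w i| <= C).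

(** Removing finitely many weights leaves an operator of norm at most [e / 2], and the removed part
    sends the unit ball into a compact set of finite combinations. *)
Lemma compact_weighted_partial_shift (A : E -> E) :
  bounded_operator A -> (forall i, A (u i) = w i *: u (sh i)) ->
  (forall e : R[i], 0 < e ->
    exists s : seq I, forall i, i \notin s -> `|w i| <= e) ->
  compact_operator A.
Proof.
move=> bA Au w0; split; first exact: bA.1.
apply: totally_bounded_precompact => e e0.
have e20 : 0 < e / 2 by rewrite divr_gt0.
have [s0 ws0] := w0 _ e20; pose s := undup s0.
have us : uniq s by exact: undup_uniq.
have ws i : i \notin s -> `|w i| <= e / 2 by rewrite mem_undup; exact: ws0.
pose w' i := if i \in s then 0 else w i.
have w'nz i : w' i != 0 -> w i != 0.
  by rewrite /w'; case: ifP; rewrite ?eqxx.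
have [|i|A' [bA' A'u A'e]] := @weighted_partial_shift _ _ _ _ u_onb sh w' _
    (e / 2) (ltW e20).
- by move=> i j /w'nz wi /w'nz wj; exact: sh_inj.
- by rewrite /w'; case: ifPn => [_|/ws//]; rewrite normr0 ltW.
have [D cD DP] := compact_combinations s (u \o sh) C.
exists D => // _ [x /= x1 <-].
exists (partial_shift u sh w s x).
  apply: DP => i; rewrite normrM -[leRHS]mulr1 ler_pM //.
  rewrite (le_trans (cauchy_schwarz _ _)) // (onb_norm u_onb) mulr1 //.
suff -> : A x = A' x + partial_shift u sh w s x.
  rewrite addrK (le_lt_trans (A'e x)) //.
  by rewrite (le_lt_trans (ler_wpM2l (ltW e20) x1)) // mulr1 gtr_pMr // invf_lt1 // ltr1n.
have bP : bounded_operator (partial_shift u sh w s).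
  apply/bounded_operatorP; split; first exact: partial_shift_linear.
  by exists C => // y; apply: partial_shift_le.
apply: (onb_eq u_onb bA (B := fun x => A' x + partial_shift u sh w s x)).
  split=> [a y t|y]; last by apply: cvgD; [exact: bA'.2|exact: bP.2].
  by rewrite bA'.1 bP.1 scalerDr addrACA.
move=> i; rewrite Au A'u partial_shift_onb // /w'.
by case: ifP => _; rewrite ?scale0r ?add0r ?addr0.
Qed.

End CompactShift.

(** * Tensor products of orthonormal bases *)

Section ClosedSpan.
Context {R : realType} {E : hilbertType R} (A : set E).

(** The closure of the span, written in the approximation form used by [closed_subspace_total]. *)
Definition closed_span : set E := [set x | forall e : R[i], 0 < e ->
  exists2 y, linear_span A y & `|x - y| < e].

Lemma sub_closed_span : A `<=` closed_span.
Proof.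
move=> x Ax e e0; exists x; last by rewrite subrr normr0.
by move=> M [_]; exact.
Qed.

Lemma closed_span_subspace : linear_subspace closed_span.
Proof.
split=> [e e0|a x y xA yA e e0].
  by exists 0; [move=> M [[]]|rewrite subrr normr0].
have a0 : 0 < `|a| + 1 by rewrite ltr_wpDl.
have e20 : 0 < e / 2 by rewrite divr_gt0.
have [x' Ax' xx'] := xA _ (divr_gt0 e20 a0).
have [y' Ay' yy'] := yA _ e20.
exists (a *: x' + y').
  by move=> M [lM AM]; apply: lM.2; [apply: Ax'|apply: Ay'].
rewrite opprD addrACA -scalerBr [e]splitr (le_lt_trans (ler_normD _ _)) //.
rewrite ler_ltD // normrZ (le_trans (ler_wpM2l _ (ltW xx'))) // mulrCA.
by rewrite ger_pMr // ler_pdivrMr // mul1r lerDl.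
Qed.

Lemma closed_span_closed x :
  (forall e : R[i], 0 < e -> exists2 y, closed_span y & `|x - y| < e) ->
  closed_span x.
Proof.
move=> xA e e0; have e20 : 0 < e / 2 by rewrite divr_gt0.
have [y yA xy] := xA _ e20; have [z Az yz] := yA _ e20.
exists z => //; rewrite -(subrK y x) -addrA [e]splitr.
by rewrite (le_lt_trans (ler_normD _ _)) // ltrD.
Qed.

Lemma closed_span_dense : (forall x, closed_span x) -> dense (linear_span A).
Proof.
move=> allA U [x Ux] oU.
have /nbhs_ballP[e /= e0 eU] : nbhs x U by exact: open_nbhs_nbhs.
have [y Ay xy] := allA x e e0; exists y; split=> //.
by apply: eU; rewrite -ball_normE.
Qed.

End ClosedSpan.

Section TensorProduct.
Context {R : realType} {H F E : hilbertType R} (tens : {bilinear H -> F -> E}).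
Hypothesis tensP : hilbert_tensor_product tens.

Lemma norm_tens x y : `|tens x y| = `|x| * `|y|.
Proof.
apply/eqP; rewrite -(@eqrXn2 _ 2) ?mulr_ge0 // exprMn -!inner_norm.
by rewrite tensP.1.
Qed.

Lemma tens_bounded x : bounded_operator (tens x).
Proof.
apply/bounded_operatorP; split; first by move=> a y z; exact: linearPr.
by exists `|x| => // y; rewrite norm_tens.
Qed.

Lemma tensl_bounded y : bounded_operator (fun x => tens x y).
Proof.
apply/bounded_operatorP; split; first by move=> a x z; exact: linearPl.
by exists `|y| => // x; rewrite norm_tens mulrC.
Qed.

Context {I J : eqType} (v : I -> H) (e : J -> F).
Hypotheses (v_onb : orthonormal_basis v) (e_onb : orthonormal_basis e).

(** Orthonormality is multiplicativity of the inner product. For totality, the closed span of the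
    products is shown to contain every simple tensor, expanding one factor at a time. *)
Lemma tens_onb : orthonormal_basis (fun p : I * J => tens (v p.1) (e p.2)).
Proof.
split=> [[i j] [k l]|].
  by rewrite tensP.1 v_onb.1 e_onb.1 xpair_eqE -natrM mulnb.
set u := fun p => _; set A := closed_span (range u).
have lA : linear_subspace A by exact: closed_span_subspace.
have clA x : (forall e : R[i], 0 < e -> exists2 y, A y & `|x - y| < e) -> A x.
  exact: closed_span_closed.
(* The preimage of a closed subspace under a bounded operator is a closed subspace, so checking it
   on a total set suffices. *)
have pull (G : hilbertType R) (B : G -> E) (S : set G) : bounded_operator B ->
    dense (linear_span S) -> (forall x, S x -> A (B x)) -> forall x, A (B x).
  move=> bB dS SA.
  apply: (closed_subspace_total (P := A \o B) dS).
  - split=> [|a x y /= Ax Ay]; first by rewrite /= (bounded_operator0 bB); exact: lA.1.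
    by rewrite bB.1; exact: lA.2.
  - exact: SA.
  move=> x xP; apply: clA => d d0.
  have /bounded_operatorP[_ [C C0 BC]] := bB.
  have c0 : 0 < C + 1 by rewrite ltr_wpDl.
  have [y Ay xy] := xP _ (divr_gt0 d0 c0); exists (B y) => //.
  rewrite -(bounded_operatorB _ _ bB).
  have [-> |xy0] := eqVneq (x - y) 0.
    by rewrite (bounded_operator0 bB) normr0.
  rewrite (le_lt_trans (BC _)) //.
  rewrite (@lt_le_trans _ _ ((C + 1) * `|x - y|)) //.
    by rewrite ltr_pM2r ?ltrDl // normr_gt0.
  by rewrite mulrC -ler_pdivlMr // ltW.
apply: closed_span_dense; apply: (closed_subspace_total tensP.2) => //.
move=> _ [[x y] _ <-] /=.
apply: (pull _ (fun x => tens x y) _ (tensl_bounded y) v_onb.2) => _ [i _ <-].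
apply: (pull _ (tens (v i)) _ (tens_bounded (v i)) e_onb.2) => _ [j _ <-].
by apply: sub_closed_span; exists (i, j).
Qed.

(** Both sides are bounded and linear in each factor separately, so two uses of [onb_eq] suffice. *)
Lemma ampliation_ext (A : H -> H) (B : E -> E) :
  bounded_operator A -> bounded_operator B ->
  (forall i j, B (tens (v i) (e j)) = tens (A (v i)) (e j)) ->
  forall x y, B (tens x y) = tens (A x) y.
Proof.
move=> bA bB BA x y.
have bl z : bounded_operator (fun x => B (tens x z)).
  exact: bounded_operator_comp bB (tensl_bounded z).
have br z : bounded_operator (fun x => tens (A x) z).
  exact: bounded_operator_comp (tensl_bounded z) bA.
apply: (onb_eq v_onb (bl y) (br y)) => i {x}.
exact: (onb_eq e_onb (bounded_operator_comp bB (tens_bounded (v i)))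
  (tens_bounded (A (v i))) (BA i) y).
Qed.

Lemma ampliation_spec (A : H -> H) :
  (exists B, bounded_operator B /\ forall x y, B (tens x y) = tens (A x) y) ->
  bounded_operator (ampliation tens A) /\
  forall x y, ampliation tens A (tens x y) = tens (A x) y.
Proof. by move=> [B AB]; rewrite /ampliation; case: xgetP => [_ -> //|/(_ B)]. Qed.

End TensorProduct.

(** * Weighted multi-shifts *)

Lemma conjC_real_complex (R : realType) (r : R) : (r%:C%C)^* = r%:C%C.
Proof. by apply: conj_Creal; rewrite complex_real. Qed.

Section Adjoints.
Context {R : realType} {H E F : hilbertType R}.

Lemma adj_onb {I J : eqType} (u : I -> H) (v : J -> E) (A : H -> E)
    (B : E -> H) :
  orthonormal_basis u -> orthonormal_basis v ->
  bounded_operator A -> bounded_operator B ->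
  (forall i j, inner (A (u i)) (v j) = inner (u i) (B (v j))) ->
  adj A =1 B.
Proof.
move=> u_onb v_onb bA bB AB.
have {}AB := onb_adjoint u_onb v_onb bA bB AB.
have [_ adjA] : bounded_operator (adj A) /\
    forall x y, inner (A x) y = inner x (adj A y).
  by apply: adj_spec; exists B.
by move=> y; apply: (onb_inner_inj u_onb) => i; rewrite -adjA AB.
Qed.

Definition adjointable (A : H -> E) := exists B,
  bounded_operator B /\ forall x y, inner (A x) y = inner x (B y).

(** Boundedness of [A] makes the set of norms bounded above, so that its [sup] is an upper bound. *)
Lemma opnorm_ge (A : H -> E) x : bounded_operator A -> `|x| <= 1 ->
  complex.Re `|A x| <= opnorm A.
Proof.
move=> /bounded_operatorP[_ [C C0 AC]] x1; apply: ub_le_sup; last by exists x.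
exists (complex.Re C) => _ [y y1 <-].
have : `|A y| <= C by rewrite (le_trans (AC y)) // ler_piMr.
by rewrite lecE => /andP[].
Qed.

End Adjoints.

Lemma adjointable_comp (R : realType) (H E F : hilbertType R)
    (A : E -> F) (B : H -> E) :
  adjointable A -> adjointable B -> adjointable (A \o B).
Proof.
move=> [A' [bA' AA']] [B' [bB' BB']]; exists (B' \o A'); split.
  exact: bounded_operator_comp.
by move=> x y /=; rewrite AA' BB'.
Qed.

Section Backward.
Context {R : realType} {n : nat} (kappa : seq 'I_n -> R).

(* The weights of the adjoint shift: v (i :: a) goes back to v a. *)
Definition backward (i : 'I_n) (b : seq 'I_n) : R :=
  if ohead b == Some i then kappa b else 0.

(** A nonzero weight forces the first letter to be [i], and that letter is all that [behead]
    forgets. The empty word has weight 0. *)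
Lemma backward_inj i a b : backward i a != 0 -> backward i b != 0 ->
  behead a = behead b -> a = b.
Proof.
rewrite /backward; case: a => [|j a] /=; first by rewrite eqxx.
case: b => [|k b] /=; first by rewrite eqxx.
case: ifP => [/eqP[->] _|_]; last by rewrite eqxx.
by case: ifP => [/eqP[->] _ ->|_]; rewrite ?eqxx.
Qed.

Lemma backward_le (c : R) i b : 0 <= c ->
  (forall a, `|kappa (i :: a)| <= c) -> `|backward i b| <= c.
Proof.
rewrite /backward => c0 kc; case: ifP => [|_]; last by rewrite normr0.
by case: b => // j b /eqP[->].
Qed.

(** The equality of matrix coefficients that makes the backward shift the adjoint of the forward
    one. *)
Lemma delta_backward i a b : kappa (i :: a) * (i :: a == b)%:R =
  backward i b * (a == behead b)%:R.
Proof.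
rewrite /backward; case: b => [|j b] /=; first by rewrite mulr0 mul0r.
rewrite eqseq_cons eq_sym (inj_eq (@Some_inj _)); case: eqP => [->|_] /=.
  by case: eqP => [->//|_]; rewrite !mulr0.
by rewrite mulr0 mul0r.
Qed.

End Backward.

Section Multishift.
Context {R : realType} {n : nat} {H : hilbertType R}.
Context (K : 'I_n -> H -> H) (v : seq 'I_n -> H) (kappa : seq 'I_n -> R).
Hypotheses (K_bounded : forall i, bounded_operator (K i))
  (v_onb : orthonormal_basis v)
  (kappa_ge0 : forall i a, 0 <= kappa (i :: a))
  (K_v : forall i a, K i (v a) = (kappa (i :: a))%:C%C *: v (i :: a)).

Lemma kappa_norm i a : (kappa (i :: a))%:C%C = `|K i (v a)|.
Proof.
by rewrite K_v normrZ (onb_norm v_onb) mulr1 norm_real_complex ger0_norm.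
Qed.

Lemma kappa_bounded : exists2 c : R, 0 < c & forall i a, kappa (i :: a) <= c.
Proof.
have /choice[c cP] : forall i, exists c : R, forall a, kappa (i :: a) <= c.
  move=> i; have /bounded_operatorP[_ [C C0 KC]] := K_bounded i.
  exists (complex.Re C) => a; have := KC (v a).
  by rewrite -kappa_norm (onb_norm v_onb) mulr1 lecE => /andP[].
(* The sum dominates the bounds of all the finitely many [i]; adding 1 makes it positive. *)
exists (1 + \sum_i `|c i|); first by rewrite ltr_pwDl // sumr_ge0.
move=> i a; rewrite (le_trans (cP i a)) // (le_trans (ler_norm _)) //.
by rewrite (bigD1 i) //= addrCA lerDl addr_ge0 // sumr_ge0.
Qed.

Lemma adj_multishift i : exists B, [/\ bounded_operator B,
  forall x y, inner (K i x) y = inner x (B y),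
  adj (K i) =1 B
  & forall b, B (v b) = (backward kappa i b)%:C%C *: v (behead b)].
Proof.
have [c c0 cP] := kappa_bounded.
have [|||B [bB Bv _]] := @weighted_partial_shift _ _ _ _ v_onb behead
    (fun b => (backward kappa i b)%:C%C) _ (c%:C%C).
- move=> a b a0 b0; apply: (@backward_inj _ _ kappa i).
    by apply: contraNneq a0 => ->.
  by apply: contraNneq b0 => ->.
- by rewrite ler0c ltW.
- move=> b; rewrite norm_real_complex lecR backward_le ?ltW // => a.
  by rewrite ger0_norm.
have KB a b : inner (K i (v a)) (v b) = inner (v a) (B (v b)).
  rewrite K_v Bv innerZl innerZr !v_onb.1 conjC_real_complex.
  by rewrite -!(rmorph_nat (real_complex R)) -!rmorphM delta_backward.
exists B; split=> //; first exact: (onb_adjoint v_onb v_onb (K_bounded i) bB KB).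
exact: (adj_onb v_onb v_onb (K_bounded i) bB KB).
Qed.

(** The coefficient by which [word_op K w] sends [v a] to [v (w ++ a)]. *)
Fixpoint kappa_prod (w a : seq 'I_n) : R :=
  if w is i :: w' then kappa (i :: w' ++ a) * kappa_prod w' a else 1.

Lemma kappa_prod_ge0 w a : 0 <= kappa_prod w a.
Proof. by elim: w => //= i w ih; rewrite mulr_ge0. Qed.

Lemma kappa_prod_rcons w i a :
  kappa_prod (rcons w i) a = kappa_prod w (i :: a) * kappa (i :: a).
Proof.
elim: w => [|j w ih] /=; first by rewrite mulr1 mul1r.
by rewrite ih mulrA -cats1 -catA.
Qed.

Lemma word_op_multishift w a :
  word_op K w (v a) = (kappa_prod w a)%:C%C *: v (w ++ a).
Proof.
elim: w => [|i w ih]; first by rewrite scale1r.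
rewrite /word_op /= -/(word_op K w) ih (bounded_operatorZ _ _ (K_bounded i)).
by rewrite K_v scalerA -rmorphM mulrC.
Qed.

Lemma word_op_bounded w : bounded_operator (word_op K w).
Proof.
elim: w => [|i w ih]; first exact: bounded_operator_id.
exact: bounded_operator_comp (K_bounded i) ih.
Qed.

Lemma adj_word_op w : bounded_operator (adj (word_op K w)) /\
  forall x y, inner (word_op K w x) y = inner x (adj (word_op K w) y).
Proof.
apply: adj_spec; elim: w => [|i w [B [bB wB]]].
  by exists id; split=> //; exact: bounded_operator_id.
apply: (@adjointable_comp _ _ _ _ (K i)); last by exists B.
by have [B' [bB' KB' _ _]] := adj_multishift i; exists B'.
Qed.

(** Equal lengths allow an equality of concatenations to be split into equalities of prefixes and of
    suffixes. *)
Lemma adj_word_op_onb (w w' a : seq 'I_n) : size w = size w' ->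
  adj (word_op K w) (v (w' ++ a)) =
  ((w == w')%:R * kappa_prod w a)%:C%C *: v a.
Proof.
move=> sw; apply: (onb_inner_inj v_onb) => b.
rewrite -(adj_word_op w).2 word_op_multishift innerZl innerZr !v_onb.1.
rewrite conjC_real_complex eqseq_cat // -!(rmorph_nat (real_complex R)).
rewrite -!rmorphM; congr (_%:C)%C.
case: eqP => [_|_] /=; last by rewrite mulr0 !mul0r.
by case: eqP => [->|_]; rewrite ?mulr0 // !mulr1 mul1r.
Qed.

(** Basis vectors are eigenvectors: among the words of this length, only the prefix [w] survives in
    the sum. *)
Lemma word_square_sum_onb (w a : seq 'I_n) :
  word_square_sum K (size w) (v (w ++ a)) =
  (kappa_prod w a ^+ 2)%:C%C *: v (w ++ a).
Proof.
rewrite /word_square_sum (bigD1 (in_tuple w)) //= big1 ?addr0; last first.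
  move=> t /negPf tw; rewrite adj_word_op_onb ?size_tuple //.
  have -> : (tval t == w) = false by exact: tw.
  by rewrite mul0r scale0r (bounded_operator0 (word_op_bounded t)).
rewrite adj_word_op_onb // eqxx mul1r (bounded_operatorZ _ _ (word_op_bounded w)).
by rewrite word_op_multishift scalerA -rmorphM -expr2.
Qed.

Lemma kappa_prod_sqr_le w a :
  kappa_prod w a ^+ 2 <= opnorm (word_square_sum K (size w)).
Proof.
have bW : bounded_operator (word_square_sum K (size w)).
  apply: bounded_operator_sum => t.
  exact: bounded_operator_comp (word_op_bounded t) (adj_word_op t).1.
have := opnorm_ge bW (x := v (w ++ a)).
rewrite word_square_sum_onb normrZ (onb_norm v_onb) mulr1 norm_real_complex.
by rewrite ger0_norm ?sqr_ge0 //; apply.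
Qed.

(** The eigenvalues of [word_square_sum] are at most its norm, so a zero spectral radius gives decay
    of the weight products, uniformly in [a]. *)
Lemma kappa_prod_exp_le (e : R) : quasi_nilpotent K -> 0 < e ->
  exists N, forall w a, (N <= size w)%N -> kappa_prod w a <= e ^+ size w.
Proof.
move=> qK e0; have /cvgrPdist_lt/(_ e e0) := qK.
(* The successor excludes the empty word, for which the exponent [(2 * k)%:R^-1] would not be an
   actual root. *)
case=> N _ NP; exists N.+1 => w a wN; have /= := NP (size w) (ltnW wN).
set x := opnorm _; rewrite sub0r normrN ger0_norm ?powR_ge0 // => xe.
have x0 : 0 <= x by rewrite (le_trans _ (kappa_prod_sqr_le w a)) // sqr_ge0.
have w0 : (0 < 2 * size w)%N by rewrite muln_gt0 /= (leq_trans _ wN).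
rewrite -ler_sqr ?nnegrE ?kappa_prod_ge0 ?exprn_ge0 ?(ltW e0) //.
rewrite (le_trans (kappa_prod_sqr_le w a)) // -/x -exprM mulnC.
have -> : x = (x `^ (2 * size w)%:R^-1) ^+ (2 * size w).
  rewrite -powR_mulrn ?powR_ge0 // -powRrM mulVf ?powRr1 //.
  by rewrite pnatr_eq0 -lt0n.
by rewrite lerXn2r ?nnegrE ?powR_ge0 ?(ltW e0) ?(ltW xe).
Qed.

End Multishift.

(** * Renorming and decay of the weights *)

Section Renorming.
Context {R : realType} {n : nat} {H : hilbertType R}.
Context (K : 'I_n -> H -> H) (v : seq 'I_n -> H) (kappa : seq 'I_n -> R).
Hypotheses (K_bounded : forall i, bounded_operator (K i))
  (v_onb : orthonormal_basis v)
  (kappa_ge0 : forall i a, 0 <= kappa (i :: a))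
  (K_v : forall i a, K i (v a) = (kappa (i :: a))%:C%C *: v (i :: a)).

(* Rota's renorming for weights: d a is the supremum over w of
   e^-|w| kappa_prod w a. *)
Lemma kappa_renorming (e : R) : quasi_nilpotent K -> 0 < e ->
  exists (M : R) (d : seq 'I_n -> R), (forall a, 1 <= d a <= M) /\
    forall i a, kappa (i :: a) * d (i :: a) <= e * d a.
Proof.
move=> qK e0.
have [N NP] := kappa_prod_exp_le K_bounded v_onb kappa_ge0 K_v qK e0.
have [c c0 cP] := kappa_bounded K_bounded v_onb kappa_ge0 K_v.
have kc w a : kappa_prod kappa w a <= c ^+ size w.
  elim: w => //= i w ih; rewrite exprS ler_pM //.
  exact: kappa_prod_ge0.
(* Words of length at least [N] contribute at most 1 to the supremum; a shorter [w] contributes at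
   most [(c / e) ^+ size w]. *)
pose M := Num.max 1 (c / e) ^+ N.
have M1 : 1 <= M by rewrite exprn_ege1 // le_max lexx.
pose S a := [set e ^- size w * kappa_prod kappa w a | w in [set: seq 'I_n]].
have SM a x : S a x -> x <= M.
  move=> [w _ <-]; rewrite mulrC ler_pdivrMr ?exprn_gt0 //.
  have [wN|wN] := leqP N (size w).
    rewrite (le_trans (NP w a wN)) // ler_peMl // exprn_ge0 //; exact: ltW.
  rewrite -ler_pdivrMr ?exprn_gt0 //.
  rewrite (@le_trans _ _ ((c / e) ^+ size w)) //.
    by rewrite expr_div_n ler_pM2r ?kc // invr_gt0 exprn_gt0.
  rewrite (@le_trans _ _ (Num.max 1 (c / e) ^+ size w)) //.
    rewrite lerXn2r ?nnegrE ?le_max ?lexx ?orbT ?ler01 //.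
    by rewrite divr_ge0 // ltW.
  by rewrite ler_weXn2l ?le_max ?lexx // ltnW.
have S1 a : S a 1 by exists [::] => //=; rewrite expr0 invr1 mulr1.
have Sub a : has_ubound (S a) by exists M; exact: SM.
exists M, (fun a => sup (S a)); split=> [a|i a].
  apply/andP; split; first exact: ub_le_sup.
  by apply: ge_sup; [exists 1|exact: SM].
have [->|k0] := eqVneq (kappa (i :: a)) 0.
  rewrite mul0r mulr_ge0 //; first exact: ltW.
  by rewrite (le_trans ler01) // ub_le_sup.
have {k0} kgt0 : 0 < kappa (i :: a) by rewrite lt_neqAle eq_sym k0 kappa_ge0.
rewrite mulrC -ler_pdivlMr //; apply: ge_sup; first by exists 1.
(* Appending [i] to [w] turns a term of the supremum at [i :: a] into one at [a], at the cost of one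
   factor [e]. *)
move=> _ [w _ <-]; rewrite ler_pdivlMr // -mulrA -kappa_prod_rcons.
rewrite -ler_pdivrMl // mulrA -invfM -exprS.
by apply: ub_le_sup => //; exists (rcons w i); rewrite ?size_rcons.
Qed.

(** Otherwise infinitely many pairwise orthogonal vectors of norm above [e] would lie in the image
    of the unit ball, and they could not cluster. *)
Lemma kappa_compact i (e : R) : compact_operator (K i) -> 0 < e ->
  exists s : seq (seq 'I_n), forall a, a \notin s -> kappa (i :: a) <= e.
Proof.
move=> [_ +] e0; rewrite precompactE => cK; apply: contrapT => /forallNP noS.
have /choice[f fP] : forall N, exists a,
    a \notin @initial (seq 'I_n) N /\ e < kappa (i :: a).
  move=> N; have /existsNP[a /not_implyP[aN /negP]] := noS (initial N).
  by rewrite -ltNge; exists a.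
pose y N := K i (v (f N)).
have Fy : (y @ \oo) (closure (K i @` [set x | `|x| <= 1])).
  exists 0%N => // N _; apply: subset_closure; exists (v (f N)) => //=.
  by rewrite (onb_norm v_onb).
have [p [_ pP]] := cK _ _ Fy.
have e20 : 0 < (e / 2)%:C%C :> R[i] by rewrite ltcR divr_gt0.
have clus N : exists2 m, (N <= m)%N & ball p (e / 2)%:C%C (y m).
  have [||z [[m /= mN <-] zp]] := pP (y @` [set m | (N <= m)%N]) (ball p (e / 2)%:C%C).
  - by exists N => // m /= Nm; exists m.
  - exact: nbhsx_ballx.
  - by exists m.
have [m1 _ p1] := clus 0%N.
(* Beyond the code of [f m1], the word [f m1] lies in [initial m2] while [f m2] does not, so the two
   differ. *)
have [m2 m12 p2] := clus (pickle (f m1)).+1.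
have f12 : f m1 != f m2.
  apply/eqP => ff; have [] := fP m2.
  by rewrite mem_initial -ff -leqNgt leqNgt m12.
have : `|y m1 - y m2| < e%:C%C.
  move: p1 p2; rewrite -!ball_normE /= => p1 p2.
  rewrite -(subrK p (y m1)) -addrA (le_lt_trans (ler_normD _ _)) //.
  by rewrite [e]splitr rmorphD /= ltrD // distrC.
(* Testing against [v (i :: f m1)] isolates the weight [kappa (i :: f m1)], which exceeds [e]. *)
have := cauchy_schwarz (y m1 - y m2) (v (i :: f m1)).
rewrite (onb_norm v_onb) mulr1 innerBl /y !K_v !innerZl !v_onb.1 eqxx mulr1.
rewrite eqseq_cons eqxx /= eq_sym (negPf f12) mulr0 subr0 norm_real_complex.
move=> /le_lt_trans /[apply]; rewrite ltcR => /(le_lt_trans (ler_norm _)).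
by apply/negP; rewrite -leNgt ltW // (fP m1).2.
Qed.

End Renorming.

Section RealWeights.
Context {R : realType} {I : countType} {E : hilbertType R} (u : I -> E).
Hypothesis u_onb : orthonormal_basis u.

Lemma real_weighted_partial_shift (sh : I -> I) (w : I -> R) (c : R) :
  (forall i j, w i != 0 -> w j != 0 -> sh i = sh j -> i = j) ->
  0 <= c -> (forall i, `|w i| <= c) ->
  exists A : E -> E,
    bounded_operator A /\ forall i, A (u i) = (w i)%:C%C *: u (sh i).
Proof.
move=> sh_inj c0 wc.
have [|||A [bA Au _]] := @weighted_partial_shift _ _ _ _ u_onb sh
    (fun i => (w i)%:C%C) _ (c%:C%C).
- by move=> i j wi wj; apply: sh_inj;
    [apply: contraNneq wi => -> | apply: contraNneq wj => ->].
- by rewrite ler0c.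
- by move=> i; rewrite norm_real_complex lecR.
- by exists A.
Qed.

(** Real entries make [A] self-adjoint, and nonzero entries let the coefficients of [x] be recovered
    from [A x]. The range is a subspace containing every [u i], hence dense. *)
Lemma diagonal_quasi_affinity (A : E -> E) (w : I -> R) :
  bounded_operator A -> (forall i, A (u i) = (w i)%:C%C *: u i) ->
  (forall i, w i != 0) -> quasi_affinity A.
Proof.
move=> bA Au w0.
have wC0 i : (w i)%:C%C != 0 :> R[i].
  by apply: contraNneq (w0 i) => /complexI ->.
have AA : forall x y, inner (A x) y = inner x (A y).
  apply: (onb_adjoint u_onb u_onb bA bA) => i j.
  rewrite !Au innerZl innerZr conjC_real_complex u_onb.1.
  by case: eqP => [->//|_]; rewrite !mulr0.
split=> // [x y Axy|].
  apply: (onb_inner_inj u_onb) => i; apply: (mulfI (wC0 i)).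
  by rewrite -!innerZl -Au !AA Axy.
move=> O O0 oO; have [x [Ox Sx]] := u_onb.2 O O0 oO; exists x; split=> //.
apply: Sx; split=> [|_ [i _ <-]].
  split; first by exists 0 => //; rewrite (bounded_operator0 bA).
  move=> a _ _ [x' _ <-] [y' _ <-]; exists (a *: x' + y') => //.
  exact: bA.1.
exists (((w i)%:C%C)^-1 *: u i) => //.
by rewrite (bounded_operatorZ _ _ bA) Au scalerA mulVf // scale1r.
Qed.

End RealWeights.

Unset Implicit Arguments.

Theorem theorem3p3 (R : realType) (n : nat) (n_ge1 : (1 <= n)%N)
    (H : hilbertType R)
    (H_sep : separable H) (H_inf : infinite_dimensional H)
    (* the full Fock space, with orthonormal basis e *)
    (F : hilbertType R) (e : seq 'I_n -> F) (e_onb : orthonormal_basis e)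
    (* HF is the Hilbert space tensor product of H and F *)
    (HF : hilbertType R) (tens : {bilinear H -> F -> HF})
    (HF_tens : hilbert_tensor_product tens)
    (T : 'I_n -> H -> H)
    (T_bounded : forall i, bounded_operator (T i))
    (T_qnil : quasi_nilpotent T)
    (K : 'I_n -> H -> H)
    (K_shift : weighted_left_multishift K)
    (K_compact : forall i, compact_operator (K i))
    (K_qnil : quasi_nilpotent K)
    (M : set HF)
    (M_subspace : linear_subspace M) (M_closed : closed M)
    (M_invariant : forall i x, M x -> M (ampliation tens (adj (K i)) x))
    (T_similar : jointly_similar_on T M
       (fun i x => orth_proj M (ampliation tens (K i) x))) :
  exists L : 'I_n -> HF -> HF,
    (forall i, bounded_operator (L i) /\ compact_operator (L i)) /\
    exists X Y : HF -> HF,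
      [/\ quasi_affinity X, quasi_affinity Y
        & forall i,
            ampliation tens (adj (K i)) \o X =1 X \o adj (L i) /\
            Y \o ampliation tens (adj (K i)) =1 adj (L i) \o Y].

Proof.
have [K_bounded [v [kappa [v_onb kappa_ge0 _ K_v]]]] := K_shift.
(* The pair [(a, b)] indexes [v a] in the [b]-th copy of [H]. *)
pose I : countType := (seq 'I_n * seq 'I_n)%type.
pose u (p : I) : HF := tens (v p.1) (e p.2).
have u_onb : orthonormal_basis u by exact: tens_onb.
(* These bounds tend to 0 along the enumeration of words and never exceed 1, so the resulting [L] is
   bounded. *)
pose eps (b : seq 'I_n) : R := (pickle b).+1%:R^-1.
have eps0 b : 0 < eps b by rewrite invr_gt0.
have eps1 b : eps b <= 1 by rewrite invf_le1 // ler1n.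
have /choice[top /choice[d dP]] : forall b, exists (Mb : R) (db : seq 'I_n -> R),
    (forall a, 1 <= db a <= Mb) /\
    forall i a, kappa (i :: a) * db (i :: a) <= eps b * db a.
  by move=> b; exact: (kappa_renorming K_bounded v_onb kappa_ge0 K_v K_qnil (eps0 b)).
have d1 b a : 1 <= d b a by have [/(_ a)/andP[]] := dP b.
have dM b a : d b a <= top b by have [/(_ a)/andP[]] := dP b.
have d0 b a : 0 < d b a by exact: lt_le_trans ltr01 (d1 b a).
have M0 b : 0 < top b by exact: lt_le_trans (d0 b [::]) (dM b [::]).
(* On the b-th copy, conjugating K by the diagonal operator with entries d b a
   replaces the weights kappa by lam b, all of which are at most eps b. *)
pose lam b a := kappa a * d b a / d b (behead a).
have lam_ge0 b i a : 0 <= lam b (i :: a).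
  by rewrite divr_ge0 ?mulr_ge0 ?kappa_ge0 // ltW.
have lam_eps b i a : lam b (i :: a) <= eps b.
  by rewrite /lam ler_pdivrMr //; have [_] := dP b; apply.
(* On a fixed copy the new weights inherit the decay of [kappa], up to the constant [top b]. *)
have lam_kappa b i a : lam b (i :: a) <= kappa (i :: a) * top b.
  rewrite /lam -mulrA ler_wpM2l //= ler_pdivrMr // (le_trans (dM b _)) //.
  by rewrite ler_peMr // ltW.
have lam1 b i a : `|lam b (i :: a)| <= 1.
  by rewrite ger0_norm // (le_trans (lam_eps b i a)).
pose fwd i (p : I) : I := (i :: p.1, p.2).
pose bwd (p : I) : I := (behead p.1, p.2).
pose bw (w : seq 'I_n -> seq 'I_n -> R) i (p : I) := backward (w p.2) i p.1.
have bw_inj w i p q : bw w i p != 0 -> bw w i q != 0 -> bwd p = bwd q -> p = q.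
  case: p q => [a b] [c f]; rewrite /bw /bwd /= => + + [ac bf].
  by rewrite -bf => ab cb; rewrite (backward_inj ab cb ac).
have bw_le w i c : 0 <= c -> (forall b a, `|w b (i :: a)| <= c) ->
    forall p, `|bw w i p| <= c.
  by move=> c0 wc p; exact: backward_le.
have /choice[L LP] i : exists A, bounded_operator A /\
    forall p, A (u p) = (lam p.2 (i :: p.1))%:C%C *: u (fwd i p).
  apply: (@real_weighted_partial_shift _ _ _ _ u_onb (fwd i)
    (fun p => lam p.2 (i :: p.1)) 1) => //.
  by move=> [a b] [c f] _ _ [-> ->].
have /choice[L' L'P] i : exists A, bounded_operator A /\
    forall p, A (u p) = (bw lam i p)%:C%C *: u (bwd p).
  apply: (@real_weighted_partial_shift _ _ _ _ u_onb bwd (bw lam i) 1) => //.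
  - exact: bw_inj.
  - exact: bw_le.
have adjL i : adj (L i) =1 L' i.
  apply: (adj_onb u_onb u_onb (LP i).1 (L'P i).1) => p q.
  rewrite (LP i).2 (L'P i).2 innerZl innerZr conjC_real_complex !u_onb.1.
  rewrite -!(rmorph_nat (real_complex R)) -!rmorphM; congr (_%:C)%C.
  case: p q => [a b] [c f]; rewrite /bw /fwd /bwd /= !xpair_eqE.
  case: (b =P f) => [->|_]; last by rewrite !andbF !mulr0.
  by rewrite !andbT delta_backward.
have [c c0 kc] := kappa_bounded K_bounded v_onb kappa_ge0 K_v.
pose ampK i := ampliation tens (adj (K i)).
have ampP i : bounded_operator (ampK i) /\
    forall p, ampK i (u p) = (bw (fun=> kappa) i p)%:C%C *: u (bwd p).
  have [B [bB _ adjB Bv]] := adj_multishift K_bounded v_onb kappa_ge0 K_v i.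
  have [||| A [bA Au]] := @real_weighted_partial_shift _ _ _ _ u_onb bwd
      (bw (fun=> kappa) i) c.
  - exact: bw_inj.
  - exact: ltW.
  - by apply: bw_le => [|_ a]; rewrite ?ger0_norm // ltW.
  have tensZ (x : R[i]) a b : tens (x *: v a) (e b) = x *: tens (v a) (e b).
    by rewrite (bounded_operatorZ _ _ (tensl_bounded HF_tens (e b))).
  have [bamp ampE] : bounded_operator (ampK i) /\
      forall x y, ampK i (tens x y) = tens (adj (K i) x) y.
    apply: ampliation_spec; exists A; split=> //.
    have -> : adj (K i) = B by exact/funext.
    apply: (ampliation_ext HF_tens v_onb e_onb bB bA) => a b.
    by rewrite (Au (a, b)) Bv tensZ.
  by split=> // -[a b]; rewrite /u /= ampE adjB Bv tensZ.
exists L; split.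
  move=> i; split; first exact: (LP i).1.
  apply: (@compact_weighted_partial_shift _ _ _ _ u_onb (fwd i)
    (fun p => (lam p.2 (i :: p.1))%:C%C) 1 _ _ _ _ (LP i).1 (LP i).2) => //.
  - by move=> [a b] [c' f] _ _ [-> ->].
  - by move=> p; rewrite norm_real_complex lecR.
  (* Only finitely many weights exceed [r]: outside [initial N] the bound [eps b] is already below
     [r], and each of the finitely many other copies has finitely many large weights by compactness
     of [K i]. *)
  move=> _ /gt0_real_complex[r r0 ->].
  have /choice[s sP] : forall b, exists s : seq (seq 'I_n),
      forall a, a \notin s -> kappa (i :: a) <= r / top b.
    move=> b; apply: (kappa_compact v_onb K_v) => //.
    by rewrite divr_gt0.
  pose N := Num.truncn r^-1.
  exists [seq (a, b) | b <- initial N, a <- s b] => -[a b] ab.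
  rewrite norm_real_complex lecR ger0_norm //=.
  have [bN|bN] := boolP (b \in initial N).
    rewrite (le_trans (lam_kappa b i a)) // -ler_pdivlMr // sP //.
    by apply: contra ab => asb; apply/allpairsPdep; exists b, a.
  rewrite (le_trans (lam_eps b i a)) // /eps -[leRHS]invrK lef_pV2 ?posrE ?invr_gt0 //.
  rewrite ltW // (lt_le_trans (truncnS_gt _)) // ler_nat ltnS leqNgt.
  by rewrite -mem_initial.
(* On copy [b], [L i] is [D] [K i] [D^-1] with [D] diagonal of entries [d b a], so [D] and [D^-1]
   intertwine the adjoints. [X] is [D] divided by the scalar [top b], and [Y] is [D^-1]; since
   [1 <= d b a <= top b], both have entries at most 1. *)
have [||| X [bX Xu]] := @real_weighted_partial_shift _ _ _ _ u_onb id
    (fun p => d p.2 p.1 / top p.2) 1; rewrite ?ler01 //.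
  move=> p; rewrite ger0_norm ?divr_ge0 ?(ltW (d0 _ _)) ?(ltW (M0 _)) //.
  by rewrite ler_pdivrMr ?mul1r.
have [||| Y [bY Yu]] := @real_weighted_partial_shift _ _ _ _ u_onb id
    (fun p => (d p.2 p.1)^-1) 1; rewrite ?ler01 //.
  by move=> p; rewrite ger0_norm ?invr_ge0 ?(ltW (d0 _ _)) // invf_le1.
exists X, Y; split.
- apply: (diagonal_quasi_affinity u_onb bX Xu) => p.
  by rewrite mulf_neq0 ?invr_eq0 ?gt_eqF.
- apply: (diagonal_quasi_affinity u_onb bY Yu) => p.
  by rewrite invr_eq0 gt_eqF.
(* The intertwining relation for the weights. At the empty word both backward weights are 0. *)
have bwE i a b : bw lam i (a, b) * d b (behead a) =
    bw (fun=> kappa) i (a, b) * d b a.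
  rewrite /bw /backward /=; case: ifP => _; last by rewrite !mul0r.
  by rewrite /lam divfK // gt_eqF.
move=> i; have -> : adj (L i) = L' i by exact/funext.
have [bL' L'u] := L'P i; have [bamp ampu] := ampP i.
split; apply: (onb_eq u_onb); try exact: bounded_operator_comp.
  move=> [a b] /=; rewrite -/(ampK i) Xu (bounded_operatorZ _ _ bamp) ampu L'u.
  rewrite (bounded_operatorZ _ _ bX) Xu !scalerA -!rmorphM; congr (_%:C%C *: _).
  by rewrite /= [RHS]mulrA bwE -[RHS]mulrA mulrC.
move=> [a b] /=; rewrite -/(ampK i) Yu (bounded_operatorZ _ _ bL') ampu L'u.
rewrite (bounded_operatorZ _ _ bY) Yu !scalerA -!rmorphM; congr (_%:C%C *: _).
(* Multiplying by the nonzero [d b (behead a)] clears the denominator and reduces the claim to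
   [bwE]. *)
rewrite /=; apply: (mulIf (lt0r_neq0 (d0 b (behead a)))).
by rewrite mulfVK ?gt_eqF // -[RHS]mulrA bwE mulrCA mulVf ?mulr1 // gt_eqF.
Qed.
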